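(* Let $\alpha=(\alpha_1,\dots,\alpha_m)$ be a strong composition of $n\ge1$ and $\delta=(\delta_1,\dots,\delta_m)$ a weak composition of $k$ with $\delta_1=0$. Set $n_\ell=\alpha_1+\cdots+\alpha_\ell$ and $k_\ell=\delta_1+\cdots+\delta_\ell$. Then $$\widetilde{\mathcal{W}}_{\alpha,\delta}^{\mathrm{maj}}(q)=\prod_{\ell=2}^m q^{k_\ell\alpha_\ell}\binom{n_{\ell-1}-k_{\ell-1}}{\delta_\ell}_q\left(\!\!\binom{k_\ell}{\alpha_\ell-\delta_\ell}\!\!\right)_{q^{-1}}=q^{\eta(\alpha,\delta)}\prod_{\ell=2}^m\binom{n_{\ell-1}-k_{\ell-1}}{\delta_\ell}_q\left(\!\!\binom{k_\ell}{\alpha_\ell-\delta_\ell}\!\!\right)_q,$$ where $\eta(\alpha,\delta)=n-\alpha_1+\binom{k}{2}+\sum_{\ell=2}^m\binom{\delta_\ell}{2}$.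
   Context: A word of length $n$ is a sequence $w=w_1\cdots w_n$ of positive integers; its content is the sequence whose $j$-th entry is the number of $j$'s. $\mathrm{maj}(w)=\sum_{1\le i<n,\,w_i>w_{i+1}}i$. $\mathrm{cdes}(w)=\#\{1\le i\le n:w_i>w_{i+1}\}$ with indices mod $n$ (empty word: 0). $w^{(i)}$ is the subsequence of letters $\le i$. For $w$ of content $\alpha$ with $m$ parts, $\mathrm{CDT}(w)=(\mathrm{cdes}(w^{(1)}),\mathrm{cdes}(w^{(2)})-\mathrm{cdes}(w^{(1)}),\dots,\mathrm{cdes}(w^{(m)})-\mathrm{cdes}(w^{(m-1)}))$. $\widetilde{\mathcal{W}}_{\alpha,\delta}$ is the set of words with content $\alpha$, $\mathrm{CDT}=\delta$, and last letter $1$; $\widetilde{\mathcal{W}}_{\alpha,\delta}^{\mathrm{maj}}(q)=\sum_{w\in\widetilde{\mathcal{W}}_{\alpha,\delta}}q^{\mathrm{maj}(w)}$. $q$-analogues: $[a]_q=1+q+\cdots+q^{a-1}$, $[a]_q!=[a]_q\cdots[1]_q$, $\binom{a}{b}_q=\frac{[a]_q!}{[b]_q![a-b]_q!}$ for $0\le b\le a$ and $0$ otherwise (equivalently $q^{-\binom b2}e_b(1,q,\dots,q^{a-1})$); $\left(\!\binom{N}{j}\!\right)_q=h_j(1,q,\dots,q^{N-1})$, the complete homogeneous symmetric polynomial, which equals $\binom{N+j-1}{j}_q$ for $N\ge1$, equals $1$ if $N=j=0$, and $0$ if $N=0<j$. The subscript $q^{-1}$ means substitute $q^{-1}$ for $q$.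 *)

(* Defs.v *)
From HB Require Import structures.
From mathcomp Require Import all_boot all_order all_algebra.
Set Implicit Arguments.
Unset Strict Implicit.
Unset Printing Implicit Defensive.
Import Order.TTheory GRing.Theory Num.Theory.
Local Open Scope ring_scope.

(* [entry s i] is the i-th entry of [s], counted from 1. *)
Definition entry (s : seq nat) (i : nat) : nat := nth 0%N s i.-1.

Definition strong_composition (n : nat) (s : seq nat) : bool :=
  all (fun a => 0 < a)%N s && (sumn s == n).

Definition weak_composition (k : nat) (s : seq nat) : bool := sumn s == k.

Definition psum (s : seq nat) (l : nat) : nat :=
  (\sum_(1 <= i < l.+1) entry s i)%N.

Definition content (m : nat) (w : seq nat) : seq nat :=
  [seq count_mem j w | j <- iota 1 m].

Definition maj (w : seq nat) : nat :=
  (\sum_(1 <= i < size w | entry w i > entry w i.+1) i)%N.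

(* The position following [i] cyclically is [(i %% size w).+1]. *)
Definition cdes (w : seq nat) : nat :=
  (\sum_(1 <= i < (size w).+1 | entry w i > entry w (i %% size w).+1) 1)%N.

Definition letters_le (i : nat) (w : seq nat) : seq nat :=
  [seq x <- w | (x <= i)%N].

(* The differences are taken in [int]; meaningful for [0 < m]. *)
Definition cdt (m : nat) (w : seq nat) : seq int :=
  (cdes (letters_le 1 w))%:Z ::
  [seq (cdes (letters_le l w))%:Z - (cdes (letters_le l.-1 w))%:Z
     | l <- iota 2 m.-1].

(* A word of length n and content alpha = (alpha_1, .., alpha_m) has all its
   letters in {1, .., m}, hence the finite carrier [n.-tuple 'I_m.+1]. *)
Definition word_of n m (w : n.-tuple 'I_m.+1) : seq nat := map val w.

Definition cdt_words (n m : nat) (alpha delta : seq nat) :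
    {set n.-tuple 'I_m.+1} :=
  [set w | [&& all (fun x => 0 < x)%N (word_of w),
               content m (word_of w) == alpha,
               cdt m (word_of w) == map Posz delta
             & last 0%N (word_of w) == 1%N]].

Definition cdt_words_maj (R : nzRingType) (n m : nat) (alpha delta : seq nat)
    (q : R) : R :=
  \sum_(w in cdt_words n m alpha delta) q ^+ maj (word_of w).

Definition qint (F : fieldType) (q : F) (a : nat) : F := \sum_(i < a) q ^+ i.

Definition qfact (F : fieldType) (q : F) (a : nat) : F :=
  \prod_(1 <= i < a.+1) qint q i.

(* The upper argument is an integer because n_(l-1) - k_(l-1) may be
   negative. *)
Definition qbinom (F : fieldType) (q : F) (a : int) (b : nat) : F :=
  if b%:Z <= a then qfact q `|a|%N / (qfact q b * qfact q (`|a|%N - b)) else 0.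

(* Complete homogeneous symmetric polynomial h_j(x_1, .., x_N): sum over the
   weakly increasing index sequences of length j; h_j = 0 for j < 0. *)
Definition complete_hom (R : comNzRingType) (N : nat) (x : 'I_N -> R) (j : int)
    : R :=
  match j with
  | Posz j =>
      \sum_(t : j.-tuple 'I_N | sorted leq (map val t)) \prod_(i <- t) x i
  | Negz _ => 0
  end.

Definition qmultichoose (F : fieldType) (q : F) (N : nat) (j : int) : F :=
  complete_hom (fun i : 'I_N => q ^+ i) j.

Definition eta_exponent (n m k : nat) (alpha delta : seq nat) : nat :=
  (n - entry alpha 1 + 'C(k, 2) + \sum_(2 <= l < m.+1) 'C(entry delta l, 2))%N.

(* The indeterminate q, in the fraction field of Z[q]. *)
Definition qvar : {fraction {poly int}} := @FracField.tofrac {poly int} 'X.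

(* Main.v *)
Require Import Defs.
From HB Require Import structures.
From mathcomp Require Import all_boot all_order all_algebra.
From mathcomp Require Import ring zify.
Import Order.TTheory GRing.Theory Num.Theory.
Local Open Scope ring_scope.

Set Implicit Arguments.
Unset Strict Implicit.
Unset Printing Implicit Defensive.

(* A word w over {1, .., M} ending in 1 arises from the word v of its letters
   < M by inserting the a copies of M in the gaps before the letters of v.  A
   nonempty block of M's creates a cyclic descent exactly when its gap was not
   a descent of v.  Reading v from the right, one letter at a time, gives a
   recursion for the generating function by maj of the insertions with D
   descents; its solution depends on v only through maj v, its number K of
   descents and its number U of nondescents, and with d = D - K is
     q^(maj v) q^(D d) [U choose d]_q h_(a-d)(q, .., q^D).
   The recursion reduces to the q-Pascal rule and to the recursion of h_j on
   its first variable.  Iterating over M = 2, .., m gives the product. *)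

(** * Words over a finite alphabet as duplicate-free lists *)

Definition tuple_words n m (P : pred (seq nat)) : seq (seq nat) :=
  [seq map val (tval t) | t <- enum [pred t : n.-tuple 'I_m | P (map val t)]].

Lemma tuple_words_uniq n m P : uniq (tuple_words n m P).
Proof.
by rewrite map_inj_uniq ?enum_uniq // => s t /(inj_map val_inj) /val_inj.
Qed.

Lemma mem_tuple_words n m P x :
  (x \in tuple_words n m P) = [&& size x == n, all (gtn m) x & P x].
Proof.
apply/mapP/and3P => [[t]|[/eqP szx ltx Px]].
  rewrite mem_enum inE => Pt ->; split=> //; first by rewrite size_map size_tuple.
  by apply/allP => _ /mapP[i _ ->] /=.
case: m ltx => [|m] ltx.
  case: x ltx szx Px => // _ szx Px; case: _ / szx.
  by exists [tuple] => //; rewrite mem_enum inE.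
have szt : size (map (@inord m) x) == n by rewrite size_map szx.
have tx : x = map val (Tuple szt).
  rewrite /= -map_comp -[LHS]map_id; apply/eq_in_map => i /(allP ltx) lti /=.
  by rewrite inordK.
by exists (Tuple szt) => //; rewrite mem_enum inE -tx.
Qed.

(** Over lists, a bijection behind an equality of sums reduces to comparing the members of two
    duplicate-free lists. *)
Lemma big_tuple_words (R : nmodType) n m P (f : seq nat -> R) :
  \sum_(t : n.-tuple 'I_m | P (map val t)) f (map val t)
    = \sum_(x <- tuple_words n m P) f x.
Proof. by rewrite big_map big_enum. Qed.

(** * Complete homogeneous symmetric polynomials *)

Section CompleteHom.
Variable R : comNzRingType.

Lemma eq_complete_hom N (x y : 'I_N -> R) j :
  x =1 y -> complete_hom x j = complete_hom y j.
Proof.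
by case: j => // j exy; apply: eq_bigr => t _; apply: eq_bigr => i _.
Qed.

Lemma complete_hom_lt0 N (x : 'I_N -> R) j : j < 0 -> complete_hom x j = 0.
Proof. by case: j. Qed.

Lemma complete_hom0 N (x : 'I_N -> R) : complete_hom x 0 = 1.
Proof.
rewrite /complete_hom /= (big_pred1 [tuple]) ?big_nil // => t.
by rewrite tuple0 /= eqxx.
Qed.

Lemma complete_homZ N (x : 'I_N -> R) c (j : nat) :
  complete_hom (fun i => c * x i) j = c ^+ j * complete_hom x j.
Proof.
rewrite /= big_distrr /=; apply: eq_bigr => t _.
by rewrite big_split /= big_const_seq count_predT size_tuple -Monoid.iteropE.
Qed.

(** Reversing an index sequence and flipping each index is an involution that preserves weak
    increase. *)
Lemma complete_hom_rev N (x : 'I_N -> R) j :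
  complete_hom (fun i => x (rev_ord i)) j = complete_hom x j.
Proof.
case: j => //= j.
pose rv (t : j.-tuple 'I_N) := [tuple of rev (map (@rev_ord N) t)].
have rvK : involutive rv.
  move=> t; apply/val_inj; rewrite /= map_rev revK -map_comp.
  by rewrite (eq_map (@rev_ordK N)) map_id.
rewrite [RHS](reindex_inj (inv_inj rvK)) /=; apply: eq_big => t.
  rewrite map_rev rev_sorted -map_comp !sorted_map.
  case: (tval t) => //= a s; elim: s a => //= b s IH a; rewrite IH; congr (_ && _).
  have := ltn_ord a; have := ltn_ord b; lia.
by move=> _; rewrite (perm_big _ (permEl (perm_rev _))) big_map.
Qed.

Lemma complete_homS N (x : nat -> R) (j : int) :
  complete_hom (fun i : 'I_N.+1 => x i) j
    = x 0%N * complete_hom (fun i : 'I_N.+1 => x i) (j - 1)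
      + complete_hom (fun i : 'I_N => x i.+1) j.
Proof.
case: j => [[|j]|j]; last by rewrite !complete_hom_lt0 ?mulr0 ?addr0 //; lia.
  by rewrite !complete_hom0 complete_hom_lt0 ?mulr0 ?add0r //; lia.
have -> : j.+1%:Z - 1 = j by lia.
pose f (y : nat -> R) (s : seq nat) := \prod_(i <- s) y i.
have homE M (y : nat -> R) k : complete_hom (fun i : 'I_M => y i) (Posz k)
    = \sum_(s <- tuple_words k M (sorted leq)) f y s.
  rewrite -(@big_tuple_words _ k M (sorted leq)) /complete_hom.
  by apply: eq_bigr => t _; rewrite /f big_map.
rewrite !homE (homE N (x \o succn)).
set A := tuple_words j _ _; set B := tuple_words j.+1 N _.
have -> : \sum_(s <- B) f (x \o succn) s = \sum_(s <- map (map succn) B) f x s.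
  by rewrite [RHS]big_map; apply: eq_bigr => s _; rewrite /f big_map.
have -> : x 0%N * \sum_(s <- A) f x s = \sum_(s <- map (cons 0%N) A) f x s.
  by rewrite [RHS]big_map big_distrr; apply: eq_bigr => s _; rewrite /f big_cons.
rewrite -big_cat; apply/perm_big/uniq_perm; first exact: tuple_words_uniq.
  have inj0 : injective (cons 0%N) by move=> s t [].
  rewrite cat_uniq (map_inj_uniq inj0) (map_inj_uniq (inj_map succn_inj)).
  rewrite !tuple_words_uniq andbT /=; apply/hasPn => _ /mapP[s _ ->].
  by apply/mapP => -[t _]; case: s.
move=> s; rewrite mem_cat mem_tuple_words; apply/and3P/orP.
  case: s => [|[|a] s] [//= szs lts srs]; [left|right].
    apply: map_f; rewrite mem_tuple_words -eqSS szs lts.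
    exact: (path_sorted srs).
  (* Sortedness spreads positivity from the first entry to all, so [succn] undoes [predn]. *)
  have pos : all (leq 1) (a.+1 :: s).
    apply: order_path_min; first exact: leq_trans.
    by rewrite /= srs.
  have -> : a.+1 :: s = map succn (map predn (a.+1 :: s)).
    rewrite -map_comp -[LHS]map_id; apply/eq_in_map => b /(allP pos) /=.
    by case: b.
  apply: map_f; rewrite mem_tuple_words size_map szs /=.
  have -> : path leq a (map predn s).
    by rewrite (homo_path _ srs : path leq a.+1.-1 _) // => b c; lia.
  rewrite andbT all_map; case/andP: lts => lta lts; rewrite -ltnS lta /=.
  case/andP: pos => _ pos; apply/allP => b bs /=.
  have := allP lts _ bs; have /= := allP pos _ bs; lia.
case=> /mapP[t]; rewrite mem_tuple_words => /and3P[szt ltt srt] -> /=.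
  rewrite eqSS szt ltt; split=> //; rewrite path_min_sorted //.
  exact/allP.
rewrite size_map szt all_map; split=> //.
by rewrite (homo_sorted _ _ srt).
Qed.

End CompleteHom.

(** * Gaussian binomials *)

Section GaussBinomial.

(** The q-Pascal rule avoids division; [qbinomE] links it to the quotient of q-factorials. *)
Fixpoint gauss_binom (R : nzRingType) (q : R) (n k : nat) : R :=
  match n, k with
  | _, 0%N => 1
  | 0%N, _.+1 => 0
  | n.+1, k.+1 => gauss_binom q n k + q ^+ k.+1 * gauss_binom q n k.+1
  end.

Lemma gauss_binom0 (R : nzRingType) (q : R) n : gauss_binom q n 0 = 1.
Proof. by case: n. Qed.

Lemma gauss_binom_small (R : nzRingType) (q : R) n k :
  (n < k)%N -> gauss_binom q n k = 0.
Proof.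
elim: n k => [|n IH] [|k] //= ltnk.
by rewrite !IH ?mulr0 ?addr0 //; lia.
Qed.

Variables (F : fieldType) (q : F).

Lemma qfactS n : qfact q n.+1 = qfact q n * qint q n.+1.
Proof. by rewrite /qfact big_nat_recr. Qed.

Lemma qintD a b : qint q (a + b) = qint q a + q ^+ a * qint q b.
Proof.
rewrite /qint big_split_ord /= big_distrr /=; congr (_ + _).
by apply: eq_bigr => i _; rewrite exprD.
Qed.

(** Induction on [n + k]: the two Pascal terms combine through [k+1] + q^(k+1) [n+1] = [n+k+2]. *)
Lemma gauss_binom_fact n k :
  gauss_binom q (n + k) k * (qfact q k * qfact q n) = qfact q (n + k).
Proof.
elim: {n k}(n + k)%N {-2}n {-2}k (erefl (n + k)%N) => [|s IH] n k nkE.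
  have [-> ->] : n = 0%N /\ k = 0%N by lia.
  by rewrite /qfact !big_geq // !mulr1.
case: k nkE => [|k] nkE; first by rewrite addn0 gauss_binom0 /qfact big_geq // !mul1r.
rewrite addnS /= !qfactS.
case: n nkE => [|n] nkE.
  have := IH 0%N k ltac:(lia); rewrite !add0n => e.
  rewrite (@gauss_binom_small _ _ _ k.+1) // -[in RHS]e; ring.
have e1 := IH n.+1 k ltac:(lia); have e2 := IH n k.+1 ltac:(lia).
rewrite addnS -addSn (qfactS k) in e2.
rewrite [X in _ = _ * X](_ : _ = qint q k.+1 + q ^+ k.+1 * qint q n.+1); last first.
  by rewrite -qintD; congr qint; lia.
rewrite [RHS]mulrDr -[X in _ = X * _ + _]e1 -[X in _ = _ + X * _]e2 (qfactS n); ring.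
Qed.

Hypothesis qint_neq0 : forall a, qint q a.+1 != 0.

Lemma qfact_neq0 a : qfact q a != 0.
Proof.
elim: a => [|a IH]; first by rewrite /qfact big_geq ?oner_eq0.
by rewrite qfactS mulf_neq0.
Qed.

Lemma qbinomE n k : qbinom q n%:Z k = gauss_binom q n k.
Proof.
rewrite /qbinom lez_nat absz_nat; case: leqP => [lekn|/gauss_binom_small-> //].
have [i ->] : exists i, n = (i + k)%N by exists (n - k)%N; lia.
rewrite -gauss_binom_fact addnK mulfK // mulf_neq0 ?qfact_neq0 //.
Qed.

End GaussBinomial.

(** * Inserting copies of a new letter into a word *)

(* [desc p s] and [nondesc p s] count positions of [p :: s]; the letter [p] is
   the cyclic predecessor of the first letter of [s]. *)
Fixpoint desc (p : nat) (s : seq nat) : nat :=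
  if s is x :: s' then ((p > x) + desc x s')%N else 0%N.

Fixpoint nondesc (p : nat) (s : seq nat) : nat :=
  if s is x :: s' then ((p <= x) + nondesc x s')%N else 0%N.

(* [majc p s] is [maj (p :: s)], see [maj_cons]: the descent at position i is
   counted once for each of the i suffixes containing it. *)
Fixpoint majc (p : nat) (s : seq nat) : nat :=
  if s is x :: s' then (desc p s + majc x s')%N else 0%N.

(* No [M] is ever placed after the last letter of [s]. *)
Fixpoint insertions (M a : nat) (s : seq nat) {struct s} : seq (seq nat) :=
  if s is x :: s' then
    (fix ins_before a := map (cons x) (insertions M a s')
       ++ if a is a'.+1 then map (cons M) (ins_before a') else [::]) a
  else if a is 0 then [:: [::]] else [::].

Lemma insertions_cons0 M x s :
  insertions M 0 (x :: s) = map (cons x) (insertions M 0 s).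
Proof. exact: cats0. Qed.

Lemma insertions_consS M a x s :
  insertions M a.+1 (x :: s)
    = map (cons x) (insertions M a.+1 s) ++ map (cons M) (insertions M a (x :: s)).
Proof. by []. Qed.

Lemma insertions_cons_nil M a x s w :
  w \in insertions M a (x :: s) -> w != [::].
Proof.
by case: a => [|a]; rewrite ?insertions_cons0 ?insertions_consS ?mem_cat;
  [|case/orP]; case/mapP=> v _ ->.
Qed.

Lemma insertions_uniq M a s : M \notin s -> uniq (insertions M a s).
Proof.
elim: s a => [|x s IH] a /=; first by case: a.
rewrite inE negb_or => /andP[neMx Ms].
have consI y : injective (cons y : seq nat -> seq nat) by move=> u v [].
elim: a => [|a IHa]; first by rewrite cats0 map_inj_uniq ?IH.
rewrite cat_uniq !map_inj_uniq ?IH // IHa andbT.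
apply/hasPn => _ /mapP[u _ ->]; apply/mapP => -[v _ [eMx]].
by rewrite eMx eqxx in neMx.
Qed.

(** Deleting [M] undoes insertion, so the insertions form a fibre of deletion. Since [last] defaults
    to 0, [0 < M] keeps the empty word admissible. *)
Lemma mem_insertions M a s w : (0 < M)%N -> M \notin s ->
  (w \in insertions M a s)
    = [&& [seq x <- w | x != M] == s, count_mem M w == a & last 0%N w != M].
Proof.
move=> M_gt0; elim: w a s => [|y w IH] a s.
  case: s a => [|x s] a Ms /=; first by case: a => //=; rewrite inE eq_sym -lt0n.
  by apply/negP => /insertions_cons_nil.
have consE z t u (A : seq (seq nat)) :
    (z :: u \in map (cons t) A) = (z == t) && (u \in A).
  apply/mapP/andP => [[v vA [-> ->]]|[/eqP-> uA]]; first by rewrite eqxx.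
  by exists u.
case: s a => [|x s] a Ms.
  have -> : (y :: w \in insertions M a [::]) = false by case: a.
  (* The last letter differs from [M], so it survives the filter, which cannot be empty. *)
  apply/esym/negP => /and3P[/= /eqP yw _ lastw].
  have : last y w \in [seq x <- y :: w | x != M] by rewrite mem_filter lastw mem_last.
  by rewrite /= yw.
move: (Ms); rewrite inE negb_or => /andP[neMx Ms'].
have -> : (y :: w \in insertions M a (x :: s)) =
    (y == x) && (w \in insertions M a s)
    || [&& (0 < a)%N, y == M & w \in insertions M a.-1 (x :: s)].
  by case: a => [|a];
    rewrite ?insertions_cons0 ?insertions_consS ?mem_cat !consE ?orbF.
rewrite !IH //=; case: (eqVneq y M) => [->|neyM] /=.
  rewrite (negPf neMx) /= add1n; case: a => [|a]; first by rewrite andbF.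
  rewrite /= eqSS; case: w {IH} => //= z w.
rewrite andbF orbF eqseq_cons add0n -andbA; congr (_ && _).
by case: w {IH} => //=; rewrite neyM (ltn_eqF M_gt0).
Qed.

(** * Generating function of the insertions *)

Section InsertionSum.
Variables (F : fieldType) (q : F).

(* h_j(q, .., q^D), with the variables listed in decreasing order so that
   removing the first one leaves the variables of [hq D.-1]. *)
Definition hq D (j : int) : F := complete_hom (fun i : 'I_D => q ^+ (D - i)) j.

Lemma hqS D j : hq D.+1 j = q ^+ D.+1 * hq D.+1 (j - 1) + hq D j.
Proof. exact: (complete_homS D (fun i => q ^+ (D.+1 - i))). Qed.

(* [a] is an integer so that the recursions below hold at [a = 0] too. *)
Definition insertion_gf U K (a : int) D : F :=
  if (K <= D)%N then
    q ^+ ((D - K) + D * (D - K)) * gauss_binom q U (D - K) * hq D (a - (D - K)%:Z)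
  else 0.

Lemma insertion_gf_lt0 U K a D : a < 0 -> insertion_gf U K a D = 0.
Proof.
move=> a_lt0; rewrite /insertion_gf; case: leqP => // _.
by rewrite /hq complete_hom_lt0 ?mulr0 //; lia.
Qed.

(** All terms share the same D - K, hence the same binomial; what remains is the recursion of [hq]
    on its first variable. *)
Lemma insertion_gf_desc U K a D :
  q ^+ K.+1 * insertion_gf U K.+1 a D.+1
    = q ^+ D.+1 * (q ^+ K.+1 * insertion_gf U K.+1 (a - 1) D.+1
                   + insertion_gf U K a D).
Proof.
rewrite /insertion_gf ltnS subSS; case: leqP => [leKD|]; last by rewrite !mulr0 addr0 mulr0.
have [d ->] : exists d, D = (K + d)%N by exists (D - K)%N; lia.
rewrite addKn (hqS _ (a - d%:Z)).
rewrite (_ : a - 1 - d%:Z = a - d%:Z - 1); last lia.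
have -> : (d + (K + d).+1 * d = (d + (K + d) * d) + d)%N by lia.
rewrite !exprD -addSn !exprD; ring.
Qed.

(** All terms share the same [hq]; what remains is the q-Pascal rule. For D = K the term with [K.+1]
    vanishes. *)
Lemma insertion_gf_nondesc U K a D :
  q ^+ K * insertion_gf U.+1 K a D
    = q ^+ D * (q ^+ K.+1 * insertion_gf U K.+1 (a - 1) D + insertion_gf U K a D).
Proof.
rewrite /insertion_gf; case: (ltngtP K D) => [ltKD||->].
- have [d ->] : exists d, D = (K + d.+1)%N by exists (D - K.+1)%N; lia.
  have -> : (K + d.+1 - K.+1)%N = d by lia.
  rewrite addKn (_ : a - 1 - d%:Z = a - d.+1%:Z) /=; last lia.
  have -> : (d.+1 + (K + d.+1) * d.+1 = (d + (K + d.+1) * d) + K + d.+2)%N by lia.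
  move: (hq _ _) => h; set E := (_ * d)%N.
  rewrite !exprD !exprS; ring.
- by rewrite !mulr0 addr0 mulr0.
by rewrite subnn !gauss_binom0 mulr0 add0r.
Qed.

Definition insertion_sum M p s (a D : nat) : F :=
  \sum_(w <- insertions M a s | desc p w == D) q ^+ majc p w.

(** The word starts with [x] or with an inserted [M]. Removing that letter removes [desc p w] = D
    from [majc], and one descent exactly when [x < p]; [p <= M] ensures that an inserted [M] makes
    none. *)
Lemma insertion_sum_cons M p x s a D : (p <= M)%N ->
  insertion_sum M p (x :: s) a D
    = q ^+ D * ((if (x < p)%N then
                   if D is D'.+1 then insertion_sum M x s a D' else 0
                 else insertion_sum M x s a D)
                + if a is a'.+1 then insertion_sum M M (x :: s) a' D else 0).
Proof.
move=> lepM; have qD (A : seq (seq nat)) P f :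
    q ^+ D * (\sum_(w <- A | P w) f w) = \sum_(w <- A | P w) q ^+ D * f w.
  by rewrite big_distrr.
have headE b : \sum_(w <- map (cons x) (insertions M b s) | desc p w == D)
      q ^+ majc p w
    = q ^+ D * (if (x < p)%N then
                  if D is D'.+1 then insertion_sum M x s b D' else 0
                else insertion_sum M x s b D).
  rewrite big_map /insertion_sum /=; case: ltnP => _; last first.
    by rewrite qD; apply: eq_bigr => w /eqP <-; rewrite add0n exprD.
  case: (D) qD => [|D'] qD; first by rewrite mulr0 big1.
  by rewrite qD; apply: eq_big => [w|w /eqP <-]; rewrite ?eqSS ?exprD.
have maxE b : \sum_(w <- map (cons M) (insertions M b (x :: s)) | desc p w == D)
      q ^+ majc p w = q ^+ D * insertion_sum M M (x :: s) b D.
  rewrite big_map qD /= ltnNge lepM.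
  by apply: eq_bigr => w /eqP <-; rewrite add0n exprD.
case: a => [|a]; rewrite {1}/insertion_sum.
  by rewrite insertions_cons0 headE addr0.
by rewrite insertions_consS big_cat /= headE maxE mulrDr.
Qed.

(** Induction on [s]. Since [majc] exceeds maj by the number of descents, D on the left and K on the
    right, [insertion_gf] carries an additional q^(D - K). *)
Lemma insertion_sumE M p s a D : (p < M)%N -> all (gtn M) s ->
  insertion_sum M p s a D
    = q ^+ majc p s * insertion_gf (nondesc p s) (desc p s) a D.
Proof.
elim: s p a D => [|x s IH] p a D ltpM /=.
  (* The empty word has no gap: both sides are 1 for [a = D = 0] and vanish otherwise. *)
  move=> _; rewrite /insertion_sum /insertion_gf /= mul1r subn0.
  case: a => [|a] /=; last first.
    rewrite big_nil; case: D => [|D] /=; last by rewrite mulr0 mul0r.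
    rewrite /hq /= big1 ?mulr0 // => t.
    by case/tupleP: t => -[].
  case: D => [|D] /=; rewrite big_cons big_nil ?mulr0 ?mul0r //=.
  rewrite addr0 mulr1 mul1r; exact/esym/complete_hom0.
case/andP=> ltxM ltsM.
(* After [M] the letter [x] always makes a descent, and further copies of [M] only delay it;
   induction on the number of copies left. *)
have maxE b E : insertion_sum M M (x :: s) b E
    = q ^+ (majc x s + (desc x s).+1) * insertion_gf (nondesc x s) (desc x s).+1 b E.
  elim: b E => [|b IHb] E; rewrite insertion_sum_cons // ltxM ?IHb exprD; case: E => [|E].
  - by rewrite /insertion_gf addr0 !mulr0.
  - rewrite addr0 IH // -[RHS]mulrA insertion_gf_desc (@insertion_gf_lt0 _ _ (_ - 1)) //; ring.
  - by rewrite /insertion_gf /= !(mulr0, addr0).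
  rewrite IH // -[RHS]mulrA [X in _ = _ * X]insertion_gf_desc.
  rewrite (_ : b.+1%:Z - 1 = b); last lia.
  ring.
have [ltxp|lepx] := ltnP x p.
  (* Both [p] and [M] descend to [x] and neither descends to an inserted [M], so [M] may replace
     [p]. *)
  have -> : insertion_sum M p (x :: s) a D = insertion_sum M M (x :: s) a D.
    by rewrite (insertion_sum_cons _ _ _ _ (ltnW ltpM)) insertion_sum_cons // ltxp ltxM.
  by rewrite maxE add0n add1n addnC.
rewrite (insertion_sum_cons _ _ _ _ (ltnW ltpM)) ltnNge lepx /= IH // add0n add1n.
rewrite addnC exprD -[RHS]mulrA insertion_gf_nondesc.
case: a => [|a]; first by rewrite addr0 (@insertion_gf_lt0 _ _ (_ - 1)) //; ring.
rewrite maxE exprD (_ : a.+1%:Z - 1 = a); last lia.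
ring.
Qed.

End InsertionSum.

(** * Partial sums, cyclic descents and maj *)

Lemma psumS s l : psum s l.+1 = (psum s l + entry s l.+1)%N.
Proof. by rewrite /psum big_nat_recr. Qed.

Lemma psum1 s : psum s 1 = entry s 1.
Proof. by rewrite psumS /psum big_geq. Qed.

Lemma psum_size s : psum s (size s) = sumn s.
Proof. by rewrite /psum big_add1 sumnE [RHS](big_nth 0%N). Qed.

Lemma desc_sumE x s :
  desc x s = (\sum_(0 <= i < size s) (nth 0 (x :: s) i > nth 0 s i))%N.
Proof.
elim: s x => [|y s IH] x /=; first by rewrite big_geq.
by rewrite big_nat_recl // IH.
Qed.

Lemma cdes_cons x s : cdes (x :: s) = desc (last x s) (x :: s).
Proof.
(* The last summand is the cyclic step from the last letter to the first; [desc] counts it first. *)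
rewrite /cdes big_add1 /= big_mkcond big_nat_recr //= addnC; congr addn.
  by rewrite modnn /entry /= nth_last /=; case: ltnP.
rewrite desc_sumE big_nat_cond [RHS]big_nat_cond; apply: eq_bigr => i.
by rewrite andbT => /andP[_ lti]; rewrite modn_small ?ltnS.
Qed.

Lemma maj_cons x s : maj (x :: s) = majc x s.
Proof.
have -> : maj (x :: s)
    = (\sum_(0 <= i < size s) (nth 0 (x :: s) i > nth 0 s i) * i.+1)%N.
  rewrite /maj big_add1 big_mkcond; apply: eq_bigr => i _.
  by rewrite /entry /=; case: ltnP; rewrite ?mul1n.
elim: s x => [|y s IH] x /=; first by rewrite big_geq.
rewrite -IH big_nat_recl // muln1 -addnA desc_sumE -big_split; congr addn.
by apply: eq_bigr => i _ /=; rewrite mulnS.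
Qed.

Lemma cdes_last1 w : all (leq 1) w -> last 0%N w = 1%N -> cdes w = desc 1 w.
Proof. by case: w => // x s _ /= lasts; rewrite cdes_cons lasts. Qed.

(** A prepended 1 creates no descent and moves every descent one position to the right. *)
Lemma majc_last1 w : all (leq 1) w -> last 0%N w = 1%N ->
  majc 1 w = (desc 1 w + maj w)%N.
Proof. by case: w => // x s _ _; rewrite maj_cons. Qed.

Lemma desc_nondesc p s : (desc p s + nondesc p s)%N = size s.
Proof. by elim: s p => //= x s IH p; rewrite -(IH x); case: ltnP => _ /=; lia. Qed.

(** The differences telescope. *)
Lemma cdtP m w (delta : seq nat) : size delta = m.+1 ->
  (cdt m.+1 w == map Posz delta)
    = all (fun l => cdes (letters_le l w) == psum delta l) (iota 1 m.+1).
Proof.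
move=> szd; have nth_delta l : (l < m.+1)%N ->
    nth 0 (map Posz delta) l = (entry delta l.+1)%:Z.
  by move=> ltl; rewrite (nth_map 0%N) ?szd.
have nth_cdt l : (l < m)%N -> nth 0 (cdt m.+1 w) l.+1
    = (cdes (letters_le l.+2 w))%:Z - (cdes (letters_le l.+1 w))%:Z.
  by move=> ltl; rewrite /= (nth_map 0%N) ?size_iota // nth_iota.
apply/eqP/allP => [e|all_psum].
  case=> [|l]; rewrite mem_iota //= => ltl.
  elim: l ltl => [|l IH] ltl; apply/eqP.
    have := nth_delta 0%N isT; rewrite -e psum1 /=; lia.
  have := nth_delta l.+1 ltac:(lia); rewrite -e nth_cdt; last lia.
  rewrite psumS; have := IH ltac:(lia); lia.
apply: (@eq_from_nth _ 0); first by rewrite /= !size_map size_iota szd.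
rewrite /= size_map size_iota => -[|l] ltl; rewrite nth_delta //.
  have := all_psum 1%N; rewrite mem_iota psum1 => /(_ isT) /eqP <-.
  by [].
rewrite (nth_cdt l) //.
have := all_psum l.+1; have := all_psum l.+2; rewrite !mem_iota psumS.
move=> /(_ ltac:(lia)) ? /(_ ltac:(lia)); lia.
Qed.

(** * All words of given content ending in 1 *)

(** Level [i] uses the letters 1, .., [i.+1], so level 0 is the single word of 1s. *)
Fixpoint inserted_words (alpha : seq nat) (i : nat) : seq (seq nat) :=
  if i is i'.+1 then
    flatten [seq insertions i'.+2 (entry alpha i'.+2) w
               | w <- inserted_words alpha i']
  else [:: nseq (entry alpha 1) 1%N].

Section InsertedWords.
Variable alpha : seq nat.
Hypothesis alpha1_gt0 : (0 < entry alpha 1)%N.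

(** Deleting the largest letter leads back to the previous level and drops the last entry of the
    content. *)
Lemma mem_inserted_words i w :
  (w \in inserted_words alpha i)
    = [&& all (fun x => 0 < x <= i.+1)%N w,
          content i.+1 w == [seq entry alpha l | l <- iota 1 i.+1]
        & last 0%N w == 1%N].
Proof.
elim: i w => [|i IH] w.
  rewrite inE; apply/eqP/and3P => [->|[all1 /eqP[<-] _]].
    split; first by apply/allP => x /nseqP[->].
      by apply/eqP; congr [:: _]; rewrite count_nseq mul1n.
    by case: (entry alpha 1) alpha1_gt0 => // a _ /=; elim: a.
  have w1 : all (pred1 1%N) w by apply/allP => x /(allP all1) /=; lia.
  by rewrite {1}(all_pred1P _ _ w1); move: w1; rewrite all_count => /eqP->.
set M := i.+2; set a := entry alpha M.
have Mfilter : M \notin [seq x <- w | x != M] by rewrite mem_filter eqxx.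
have -> : (w \in inserted_words alpha i.+1)
    = [&& [seq x <- w | x != M] \in inserted_words alpha i,
          count_mem M w == a & last 0%N w != M].
  apply/flatten_mapP/and3P => [[v vi]|[wi aw lastw]].
    have Mv : M \notin v.
      move: vi; rewrite IH => /and3P[/allP ltv _ _].
      by apply/negP => /ltv; rewrite ltnn andbF.
    by rewrite mem_insertions // => /and3P[/eqP-> -> ->].
  by exists [seq x <- w | x != M]; rewrite // mem_insertions // eqxx aw.
have iota_rcons : iota 1 i.+2 = iota 1 i.+1 ++ [:: M] by rewrite -[in LHS](addn1 i.+1) iotaD.
rewrite IH /content iota_rcons !map_cat eqseq_cat ?size_map //.
rewrite (eqseq_cons (count_mem M w) a [::] [::]) (eqxx [::]) andbT.
have -> : [seq count_mem j [seq x <- w | x != M] | j <- iota 1 i.+1]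
    = [seq count_mem j w | j <- iota 1 i.+1].
  apply/eq_in_map => j; rewrite mem_iota => ltj; rewrite count_filter.
  apply: eq_count => x /=; case: eqP => //= ->; apply/eqP; rewrite /M; lia.
(* A last letter other than [M] is still last after deletion of [M]. *)
have lastE : (last 0%N [seq x <- w | x != M] == 1%N) && (last 0%N w != M)
    = (last 0%N w == 1%N).
  case/lastP: w {Mfilter} => // w x; rewrite filter_rcons !last_rcons.
  by case: (eqVneq x M) => [->|_]; rewrite ?andbF ?last_rcons ?andbT.
have -> : all (fun x => 0 < x <= i.+1)%N [seq x <- w | x != M]
    = all (fun x => 0 < x <= M)%N w.
  rewrite all_filter; apply: eq_all => x /=; rewrite /M; lia.
rewrite -lastE; move: (all _ w) (_ == [seq entry _ _ | _ <- _]) => A B.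
by rewrite -!andbA; do 2!congr andb; rewrite andbCA.
Qed.

Lemma inserted_words_letters i w : w \in inserted_words alpha i ->
  all (leq 1) w /\ all (gtn i.+2) w.
Proof.
rewrite mem_inserted_words => /and3P[/allP lew _ _].
by split; apply/allP => x /lew /andP[].
Qed.

Lemma inserted_words_last i w :
  w \in inserted_words alpha i -> last 0%N w = 1%N.
Proof. by rewrite mem_inserted_words => /and3P[_ _ /eqP]. Qed.

Lemma inserted_words_notin i w : w \in inserted_words alpha i -> i.+2 \notin w.
Proof.
by move=> /inserted_words_letters[_ /allP lt]; apply/negP => /lt /=; rewrite ltnn.
Qed.

Lemma size_inserted_words i w :
  w \in inserted_words alpha i -> size w = psum alpha i.+1.
Proof.
elim: i w => [|i IH] w; first by rewrite inE psum1 => /eqP->; rewrite size_nseq.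
case/flatten_mapP=> v vi; rewrite mem_insertions ?inserted_words_notin //.
case/and3P=> /eqP ev /eqP aw _; rewrite psumS -(IH _ vi) -ev -aw size_filter.
by rewrite addnC count_predC.
Qed.

(** Different words [v] have disjoint sets of insertions, since deletion recovers [v]. *)
Lemma inserted_words_uniq i : uniq (inserted_words alpha i).
Proof.
elim: i => //= i IH.
have := @inserted_words_notin i; elim: (inserted_words alpha i) IH => //= v A IHA.
case/andP=> vA uA Mnotin; rewrite cat_uniq insertions_uniq ?Mnotin ?mem_head //=.
rewrite IHA // ?andbT => [|u uinA]; last by rewrite Mnotin // inE uinA orbT.
apply/hasPn => w /flatten_mapP[u uinA]; rewrite !mem_insertions ?Mnotin ?mem_head //.
  by move=> /and3P[/eqP-> _ _]; apply: contra vA => /and3P[/eqP<-].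
by rewrite inE uinA orbT.
Qed.

End InsertedWords.

(** * The factor contributed by each letter *)

Section MajFactor.
Variables (F : fieldType) (q : F).
Hypothesis q_neq0 : q != 0.

(** Homogeneity of degree a - d: q^D is taken out of each variable q^(D-i). *)
Lemma hq_qmultichoose D (a d : nat) :
  q ^+ (D * d) * hq q D (a%:Z - d%:Z)
    = q ^+ (D * a) * qmultichoose q^-1 D (a%:Z - d%:Z).
Proof.
have [ltad|leda] := ltnP a d.
  by rewrite /hq /qmultichoose !complete_hom_lt0 ?mulr0 //; lia.
rewrite subzn // -[in q ^+ (D * a)](subnKC leda) mulnDr exprD -mulrA; congr (_ * _).
rewrite exprM /qmultichoose -complete_homZ; apply: eq_complete_hom => i.
by rewrite exprVn -expfB.
Qed.

(** Reversing the variables turns q^(-i) into q^(-(D-1)) q^i, and D a - (D-1)(a-d) = D d - d + a.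
    For D = 0 both sides vanish because a > 0. *)
Lemma qmultichoose_inv D (a d : nat) : (d <= D)%N -> (0 < a)%N ->
  q ^+ (D * a) * qmultichoose q^-1 D (a%:Z - d%:Z)
    = q ^+ (D * d - d + a) * qmultichoose q D (a%:Z - d%:Z).
Proof.
move=> ledD a_gt0; have [ltad|leda] := ltnP a d.
  by rewrite /qmultichoose !complete_hom_lt0 ?mulr0 //; lia.
case: D ledD => [|D] ledD.
  have -> : d = 0%N by lia.
  case: a a_gt0 {leda} => // a _; rewrite subr0 /qmultichoose /= !big1 ?mulr0 //.
    by move=> t; case/tupleP: t => -[].
  by move=> t; case/tupleP: t => -[].
rewrite subzn //.
have -> : (D.+1 * a = (D.+1 * d - d + a) + D * (a - d))%N by nia.
rewrite [X in X * _ = _]exprD -mulrA exprM /qmultichoose -complete_homZ.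
rewrite -[in RHS]complete_hom_rev; congr (_ * _).
apply: eq_complete_hom => i /=.
by rewrite exprVn subSS expfB_cond // (negPf q_neq0) add0n -ltnS.
Qed.

Hypothesis qint_neq0 : forall a, qint q a.+1 != 0.
Variables alpha delta : seq nat.
Hypothesis alpha1_gt0 : (0 < entry alpha 1)%N.
Hypothesis delta1 : entry delta 1 = 0%N.

Definition maj_factor (l : nat) : F :=
  q ^+ (psum delta l * entry alpha l)
  * qbinom q ((psum alpha l.-1)%:Z - (psum delta l.-1)%:Z) (entry delta l)
  * qmultichoose q^-1 (psum delta l) ((entry alpha l)%:Z - (entry delta l)%:Z).

Definition has_cdes_psum (i : nat) (w : seq nat) : bool :=
  all (fun l => cdes (letters_le l w) == psum delta l) (iota 1 i.+1).

Lemma has_cdes_psumS i w :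
  has_cdes_psum i.+1 w
    = has_cdes_psum i w && (cdes (letters_le i.+2 w) == psum delta i.+2).
Proof.
have iota_rcons : iota 1 i.+2 = iota 1 i.+1 ++ [:: i.+2].
  by rewrite -[in LHS](addn1 i.+1) iotaD.
by rewrite /has_cdes_psum iota_rcons all_cat all_seq1.
Qed.

Lemma letters_le_id i w : all (gtn i.+1) w -> letters_le i w = w.
Proof. by move=> ltw; apply/all_filterP/allP => x /(allP ltw). Qed.

Lemma insertion_maj_sum i v :
  v \in inserted_words alpha i -> has_cdes_psum i v ->
  \sum_(w <- insertions i.+2 (entry alpha i.+2) v
        | cdes (letters_le i.+2 w) == psum delta i.+2) q ^+ maj w
    = q ^+ maj v * maj_factor i.+2.
Proof.
move=> vi cdes_v; set M := i.+2; set a := entry alpha M.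
have [v1 vM] := inserted_words_letters alpha1_gt0 vi.
have lastv := inserted_words_last alpha1_gt0 vi.
have dv : desc 1 v = psum delta i.+1.
  have := allP cdes_v i.+1; rewrite mem_iota letters_le_id // cdes_last1 //.
  by move=> /(_ ltac:(lia)) /eqP.
(* The upper argument of the binomial is the number U of nondescents of [v], hence nonnegative
   here. *)
have nv : (psum alpha i.+1)%:Z - (psum delta i.+1)%:Z = (nondesc 1 v)%:Z.
  by have := desc_nondesc 1 v; rewrite (size_inserted_words alpha1_gt0 vi) dv; lia.
have insP w : w \in insertions M a v ->
    [/\ all (leq 1) w, all (gtn M.+1) w & last 0%N w = 1%N].
  move=> wv; have wi : w \in inserted_words alpha i.+1 by apply/flatten_mapP; exists v.
  have [? ?] := inserted_words_letters alpha1_gt0 wi; split=> //.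
  exact: inserted_words_last wi.
have -> : \sum_(w <- insertions M a v | cdes (letters_le M w) == psum delta M)
    q ^+ maj w = q ^- psum delta M * insertion_sum q M 1 v a (psum delta M).
  rewrite /insertion_sum big_distrr /= big_seq_cond [RHS]big_seq_cond.
  apply: eq_big => [w|w /andP[/insP[w1 wM lastw]]].
    case: (boolP (w \in _)) => //= /insP[w1 wM lastw].
    by rewrite letters_le_id // cdes_last1.
  rewrite letters_le_id // cdes_last1 // majc_last1 // => /eqP <-.
  by rewrite exprD mulKf // expf_neq0.
rewrite insertion_sumE // majc_last1 // dv exprD /maj_factor nv qbinomE //.
set d := entry delta M; set K := psum delta i.+1; rewrite -/a.
have -> : psum delta M = (K + d)%N by exact: psumS.
have hE := hq_qmultichoose (K + d) a d.
(* The power q^(-(K+d)), from passing from [majc] to [maj], cancels q^K from [majc 1 v] and q^d from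
   [insertion_gf]. *)
transitivity (q ^+ maj v * gauss_binom q (nondesc 1 v) d
              * (q ^+ ((K + d) * d) * hq q (K + d) (a%:Z - d%:Z))).
  rewrite /insertion_gf leq_addr addKn (exprD _ d) exprD.
  by field; rewrite !expf_neq0.
by rewrite hE; ring.
Qed.

Lemma inserted_words_maj_sum i :
  \sum_(w <- inserted_words alpha i | has_cdes_psum i w) q ^+ maj w
    = \prod_(2 <= l < i.+2) maj_factor l.
Proof.
elim: i => [|i IH].
  (* The starting word of 1s has no descents, in agreement with [delta1]. *)
  have nseqP a p : (p <= 1)%N -> desc p (nseq a 1) = 0%N /\ majc p (nseq a 1) = 0%N.
    by elim: a p => //= a IH p lep1; have [-> ->] := IH 1%N isT; rewrite ltnNge lep1.
  have w1 : nseq (entry alpha 1) 1%N \in inserted_words alpha 0 by rewrite mem_head.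
  have [leq1 gt1] := inserted_words_letters alpha1_gt0 w1.
  have last1 := inserted_words_last alpha1_gt0 w1.
  have [desc0 majc0] := nseqP (entry alpha 1) 1%N isT.
  have maj0 := majc_last1 leq1 last1; rewrite desc0 majc0 add0n in maj0.
  rewrite big_geq //= big_mkcond big_seq1 /has_cdes_psum /= andbT.
  by rewrite letters_le_id // cdes_last1 // desc0 psum1 delta1 -maj0.
rewrite big_nat_recr //= -IH big_flatten big_map big_distrl /=.
rewrite [RHS]big_mkcond big_seq [RHS]big_seq; apply: eq_bigr => v vi.
have [v1 vM] := inserted_words_letters alpha1_gt0 vi.
(* Deleting [i.+2] keeps all smaller letters, so the earlier conditions depend only on [v]. *)
have cdes_ins w : w \in insertions i.+2 (entry alpha i.+2) v ->
    has_cdes_psum i w = has_cdes_psum i v.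
  rewrite mem_insertions ?(inserted_words_notin alpha1_gt0 vi) //.
  case/and3P=> /eqP <- _ _; apply: eq_in_all => l; rewrite mem_iota => ltl.
  rewrite /letters_le -filter_predI; congr (cdes _ == _); apply: eq_filter => x /=.
  by case: leqP => //= lexl; symmetry; apply/eqP; lia.
have -> : \sum_(w <- insertions i.+2 (entry alpha i.+2) v
                | has_cdes_psum i.+1 w) q ^+ maj w
    = \sum_(w <- insertions i.+2 (entry alpha i.+2) v
        | has_cdes_psum i v && (cdes (letters_le i.+2 w) == psum delta i.+2))
          q ^+ maj w.
  rewrite big_seq_cond [RHS]big_seq_cond; apply: eq_bigl => w.
  by case: (boolP (w \in _)) => //= wv; rewrite has_cdes_psumS cdes_ins.
by case: ifP => [/(insertion_maj_sum vi)|_] //; rewrite big_pred0.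
Qed.

Lemma mul2_bin2 n : (2 * 'C(n, 2) + n = n * n)%N.
Proof. by elim: n => // n IH; rewrite binS bin1; nia. Qed.

Lemma prod_maj_factor m : (0 < m)%N ->
  (forall l, (2 <= l < m.+1)%N -> (0 < entry alpha l)%N) ->
  \prod_(2 <= l < m.+1) maj_factor l
    = q ^+ (psum alpha m - entry alpha 1 + 'C(psum delta m, 2)
            + \sum_(2 <= l < m.+1) 'C(entry delta l, 2))
      * \prod_(2 <= l < m.+1)
          (qbinom q ((psum alpha l.-1)%:Z - (psum delta l.-1)%:Z) (entry delta l)
           * qmultichoose q (psum delta l)
               ((entry alpha l)%:Z - (entry delta l)%:Z)).
Proof.
case: m => // m _; elim: m => [|m IH] alpha_gt0.
  by rewrite !big_geq // !psum1 delta1 subnn mulr1.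
rewrite !(@big_nat_recr _ _ _ m.+2) //= IH => [|l ltl]; last by apply: alpha_gt0; lia.
(* Makes the truncated subtraction of alpha_1 exact. *)
have ge1 l : (entry alpha 1 <= psum alpha l.+1)%N.
  by elim: l => [|l IHl]; rewrite ?psum1 // psumS (leq_trans IHl) ?leq_addr.
rewrite /maj_factor [X in _ * X = _]mulrAC qmultichoose_inv; last 2 first.
- by rewrite psumS leq_addl.
- by apply: alpha_gt0; lia.
rewrite /=.
set S := (\sum_(2 <= l < m.+2) _)%N; set P := \prod_(2 <= l < m.+2) _.
set QB := qbinom _ _ _; set QM := qmultichoose _ _ _.
have ge_m := ge1 m; rewrite (psumS alpha m.+1) (psumS delta m.+1).
set K := psum delta m.+1; set d := entry delta m.+2.
(* Uses C(K+d, 2) + C(d, 2) = C(K, 2) + (K+d) d - d. *)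
have -> : (psum alpha m.+1 + entry alpha m.+2 - entry alpha 1 + 'C(K + d, 2)
    + (S + 'C(d, 2)) = (psum alpha m.+1 - entry alpha 1 + 'C(K, 2) + S)
    + ((K + d) * d - d + entry alpha m.+2))%N.
  have := mul2_bin2 K; have := mul2_bin2 d; have := mul2_bin2 (K + d); nia.
rewrite [in RHS]exprD; ring.
Qed.

End MajFactor.

(** * The indeterminate q and the final assembly *)

Lemma qvar_neq0 : qvar != 0.
Proof. by rewrite tofrac_eq0 polyX_eq0. Qed.

Lemma qint_qvar_neq0 a : qint qvar a.+1 != 0.
Proof.
rewrite /qint /qvar.
have -> : \sum_(i < a.+1) FracField.tofrac ('X : {poly int}) ^+ i
    = FracField.tofrac (\sum_(i < a.+1) 'X^i : {poly int}).
  by rewrite rmorph_sum; apply: eq_bigr => i _; rewrite rmorphXn.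
(* At 1 the polynomial takes the nonzero value [a.+1]. *)
rewrite tofrac_eq0; apply/eqP => /(congr1 (horner^~ 1)).
rewrite horner_sum horner0 (eq_bigr (fun _ => 1)); last by move=> i _; rewrite hornerXn expr1n.
by rewrite sumr_const card_ord => /eqP; rewrite pnatr_eq0.
Qed.

(** Both sides sum over duplicate-free lists with the same members; the length n is recovered from
    the content. *)
Lemma cdt_words_majE n m (alpha delta : seq nat) (R : nzRingType) (q : R) :
  strong_composition n alpha -> size alpha = m.+1 -> size delta = m.+1 ->
  cdt_words_maj n m.+1 alpha delta q
    = \sum_(w <- inserted_words alpha m | has_cdes_psum delta m w) q ^+ maj w.
Proof.
case/andP=> alpha_gt0 /eqP suma sza szd.
have alpha1_gt0 : (0 < entry alpha 1)%N by apply: (allP alpha_gt0); rewrite mem_nth ?sza.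
pose P w := [&& all (fun x => 0 < x)%N w, content m.+1 w == alpha,
                cdt m.+1 w == map Posz delta & last 0%N w == 1%N].
have -> : cdt_words_maj n m.+1 alpha delta q
    = \sum_(t : n.-tuple 'I_m.+2 | P (map val t)) q ^+ maj (map val t).
  by apply: eq_bigl => t; rewrite inE.
rewrite (@big_tuple_words _ n m.+2 P (fun w => q ^+ maj w)) -[RHS]big_filter.
apply/perm_big/uniq_perm; rewrite ?tuple_words_uniq ?filter_uniq //.
  exact: inserted_words_uniq.
have alphaE : [seq entry alpha l | l <- iota 1 m.+1] = alpha.
  apply: (@eq_from_nth _ 0%N) => [|i]; rewrite size_map size_iota ?sza // => lti.
  by rewrite (nth_map 0%N) ?size_iota // nth_iota.
move=> w; rewrite mem_tuple_words mem_filter /P cdtP // -/(has_cdes_psum delta m w).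
apply/idP/idP.
  case/and3P=> _ ltw /and4P[gt0 cw -> lastw].
  rewrite mem_inserted_words // alphaE cw lastw !andbT /=.
  by apply/allP => x xw; rewrite (allP gt0) //=; have := allP ltw x xw.
case/andP=> -> wi; have [w1 wm] := inserted_words_letters alpha1_gt0 wi.
have szw := size_inserted_words alpha1_gt0 wi.
move: wi; rewrite mem_inserted_words // alphaE => /and3P[_ -> ->].
by rewrite wm w1 szw -sza psum_size suma eqxx.
Qed.

Theorem theorem5p17 (n m k : nat) (alpha delta : m.-tuple nat)
    (hn : (1 <= n)%N)
    (halpha : strong_composition n alpha)
    (hdelta : weak_composition k delta)
    (hdelta1 : entry delta 1 = 0%N) :
  cdt_words_maj n m alpha delta qvar
    = \prod_(2 <= l < m.+1)
        (qvar ^+ (psum delta l * entry alpha l)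
         * qbinom qvar ((psum alpha l.-1)%:Z - (psum delta l.-1)%:Z)
             (entry delta l)
         * qmultichoose qvar^-1 (psum delta l)
             ((entry alpha l)%:Z - (entry delta l)%:Z))
  /\
  \prod_(2 <= l < m.+1)
        (qvar ^+ (psum delta l * entry alpha l)
         * qbinom qvar ((psum alpha l.-1)%:Z - (psum delta l.-1)%:Z)
             (entry delta l)
         * qmultichoose qvar^-1 (psum delta l)
             ((entry alpha l)%:Z - (entry delta l)%:Z))
    = qvar ^+ eta_exponent n m k alpha delta
      * \prod_(2 <= l < m.+1)
          (qbinom qvar ((psum alpha l.-1)%:Z - (psum delta l.-1)%:Z)
             (entry delta l)
           * qmultichoose qvar (psum delta l)
               ((entry alpha l)%:Z - (entry delta l)%:Z)).
Proof.
have [/allP alpha_gt0 /eqP suma] := andP halpha.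
case: m => [|m] in alpha delta halpha hdelta hdelta1 alpha_gt0 suma *.
  (* An empty [alpha] has sum 0, against [hn]. *)
  by move: hn; rewrite -suma tuple0.
have entry_gt0 l : (l < m.+1)%N -> (0 < entry alpha l.+1)%N.
  by move=> ltl; rewrite alpha_gt0 ?mem_nth ?size_tuple.
split.
  rewrite cdt_words_majE ?size_tuple // inserted_words_maj_sum ?entry_gt0 //.
  - exact: qvar_neq0.
  - exact: qint_qvar_neq0.
rewrite /eta_exponent -suma -(eqP hdelta) -!psum_size !size_tuple.
apply: prod_maj_factor; rewrite ?qvar_neq0 ?entry_gt0 // => -[|l] //= ltl.
by apply: entry_gt0; lia.
Qed.
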